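(* For $n\in\mathbb{N}$, we have $$ \sqrt{\frac{n+2}{n+4}}\,<\frac{\Omega_{n+2}^{1/(n+2)}}{\Omega_n^{1/n}} <\sqrt[4]{\frac{n+2}{n+4}}\,, $$ $$ \frac1{\pi^{2/((n-2)n)}}\sqrt{\frac{n+2}{n+4}}\, <\frac{\Omega_{n+2}^{1/n}}{\Omega_n^{1/(n-2)}} <\frac1{\pi^{2/((n-2)n)}}\sqrt[8]{\frac{n+2}{n+4}}\qquad(n\ne2), $$ $$ \sqrt{\frac{n+2}{n+3}}\, <\frac{\Omega_{n+1}^{1/(n+1)}}{\Omega_{n}^{1/n}} <\sqrt[4]{\frac{n+2}{n+3}}\,. $$
   Context: $\mathbb{N}=\{1,2,3,\dots\}$, $\Gamma$ is the classical Euler gamma function, and $$\Omega_n=\frac{\pi^{n/2}}{\Gamma(1+n/2)}$$ is the $n$-dimensional volume of the unit ball $\mathbb{B}^n$ in $\mathbb{R}^n$. *)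

(* Defs.v *)
From mathcomp Require Import all_boot all_order all_algebra.
From mathcomp Require Import all_classical all_reals all_analysis.
Import Order.TTheory GRing.Theory Num.Theory.
Import numFieldNormedType.Exports.

Set Implicit Arguments.
Unset Strict Implicit.
Unset Printing Implicit Defensive.

Local Open Scope classical_set_scope.
Local Open Scope ring_scope.

(* Euler's integral of the second kind. It is the gamma function on the
   half-line 0 < x only; for x <= 0 the integral diverges and the value of
   Rintegral is a default one. *)
Definition Gamma (R : realType) (x : R) : R :=
  \int[lebesgue_measure]_(t in `]0, +oo[) (t `^ (x - 1) * expR (- t)).

Definition Omega (R : realType) (n : nat) : R :=
  pi `^ (n%:R / 2) / Gamma (1 + n%:R / 2).

(* Main.v *)
Require Import Defs.
From mathcomp Require Import all_boot all_order all_algebra.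
From mathcomp Require Import all_classical all_reals all_analysis.
From mathcomp Require Import measurable_realfun.
From mathcomp Require Import ring lra.
Import Order.TTheory GRing.Theory Num.Theory.
Import numFieldNormedType.Exports.

(** Put [h n := ln (Gamma (1 + n / 2))], so that
    [ln (Omega n) = (n / 2) ln pi - h n].  After taking logarithms the powers
    of [pi] cancel, and the first two pairs of inequalities become a lower and
    an upper bound for [h n] alone, because [h (n + 2)] is [h n] plus
    [ln ((n + 2) / 2)].  With [D n := ln ((n + 4) / (n + 2))] the first pair is
<<
   n ln((n+2)/2) - n (n+2)/2 D n < 2 h n < n ln((n+2)/2) - n (n+2)/4 D n
>>
    and the second one, for [n >= 3], is
<<
   (n-2) ln((n+2)/2) - n (n-2)/2 D n < 2 h n < (n-2) ln((n+2)/2) - n (n-2)/8 D n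
>>
    with both inequalities reversed for [n = 1].  Such bounds go by induction
    from [n] to [n + 2]: in the increment of the difference of two sides
    everything cancels except a positive multiple of a combination of [D n] and
    [D (n + 2)], whose sign follows from [D] being decreasing and [(n + 2) D n]
    increasing ([log_Gamma_half_gt], [log_Gamma_half_lt] and their [_shift]
    variants).

    The third pair compares [h n] with [h (n + 1)], for which there is no
    functional equation.  The Cauchy-Schwarz inequality makes [h] convex
    ([log_Gamma_half_convex]), and convexity together with the functional
    equation squeezes [h (n + 1) - h n] between [ln ((n + 1) / 2) / 2] and
    [ln ((n + 2) / 2) / 2].  What remains to be shown is again a bound for [h n]
    alone, obtained by the same induction
    ([log_Gamma_half_gt_single], [log_Gamma_half_lt_single]).

    The inductions start from small cases, which are comparisons of products of
    powers of 2, 3, 5, 7 and [pi].  The bounds [3 < pi <= 256 / 75] are enough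
    for all of them, and they are themselves Wallis-type consequences of the
    convexity of [h] ([lnpi_gt], [lnpi_le]).

    The properties of [Gamma] that this needs at half-integers, namely its
    functional equation, [Gamma 2 = 1] and [Gamma (3 / 2) = sqrt pi / 2], are
    all obtained by exhibiting a primitive of the integrand ([gamma_value]). *)

Set Implicit Arguments.
Unset Strict Implicit.
Unset Printing Implicit Defensive.

Local Open Scope classical_set_scope.
Local Open Scope ring_scope.

(** * The gamma function through primitives of its integrand *)

Section gamma_value.
Context {R : realType}.
Implicit Types (x t L : R) (P : R -> R).
Notation mu := (@lebesgue_measure R).

Definition gamma_integrand x t : R := t `^ (x - 1) * expR (- t).

(** [P] is the lower incomplete gamma function
    [t |-> \int_0^t s^(x-1) e^(-s) ds] and [L] its limit, that is, the value of
    the gamma function at [x].  Asking for a primitive instead of an integral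
    makes sense for the integrand with [x = 1/2], which is unbounded at 0, and
    reduces integration by parts over the half-line to algebra on primitives. *)
Definition gamma_value x L := exists P,
  [/\ forall t, 0 < t -> is_derive t 1 P (gamma_integrand x t),
      P 0 = 0, P t @[t --> 0^'+] --> 0 & P t @[t --> +oo] --> L].

Lemma cvg_powR_expR x : t `^ x * expR (- t) @[t --> +oo] --> (0 : R).
Proof.
pose n := (Num.truncn `|x|).+1.
have xn : x <= n%:R.
  by rewrite (le_trans (ler_norm x))// ltW// truncnS_gt.
apply: (@squeeze_cvgr _ _ _ _ (cst 0) (fun t => n.+1`!%:R * t^-1)).
- near=> t; have t1 : 1 <= t by near: t; apply: nbhs_pinfty_ge; rewrite num_real.
  have t0 : 0 < t by apply: lt_le_trans t1.
  rewrite mulr_ge0 ?powR_ge0 ?expR_ge0//=.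
  rewrite expRN ler_pdivrMr ?expR_gt0// -ler_pdivrMl; last first.
    by rewrite mulr_gt0 ?invr_gt0// ltr0n fact_gt0.
  apply: (@le_trans _ _ (t ^+ n.+1 / n.+1`!%:R)).
    rewrite exprS invf_div.
    rewrite [leLHS](_ : _ = t * t `^ x / n.+1`!%:R); last by ring.
    rewrite ler_pM2r ?invr_gt0 ?ltr0n ?fact_gt0// ler_pM2l//.
    by rewrite -(powR_mulrn _ (ltW t0)); exact: ler_powR.
  by apply: le_trans (expR_ge1Dxn n (ltW t0)); rewrite lerDr.
- exact: cvg_cst.
- rewrite -[X in _ --> X](mulr0 (n.+1`!%:R)); apply: cvgMr.
  by apply/gtr0_cvgV0 => //; near=> t.
Unshelve. all: by end_near. Qed.

(** Integration by parts: [x P(t) - t^x e^(-t)] is a primitive of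
    [t^x e^(-t)], and the boundary term vanishes at both ends. *)
Lemma gamma_valueS x L : 0 < x -> gamma_value x L -> gamma_value (x + 1) (x * L).
Proof.
move=> x0 [P [dP P0 P0r Py]].
exists (fun t => x * P t - t `^ x * expR (- t)); split.
- move=> t t0; have dPt := dP t t0.
  have dx := is_derive1_powR x t0.
  apply: is_derive_eq.
  rewrite /gamma_integrand addrK /GRing.scale/=.
  ring.
- by rewrite P0 powR0 ?gt_eqF// mulr0 mul0r subr0.
- rewrite -[X in _ --> X](subr0) -[X in _ --> X - _](mulr0 x).
  rewrite -[X in _ --> _ - X](mul0r (expR (- 0))).
  apply: cvgB; first exact: cvgMr.
  apply: cvgM; first exact: powR_cvg0.
  apply: cvg_at_right_filter; apply: continuous_comp; first exact: continuousN.
  exact: continuous_expR.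
- rewrite -[X in _ --> X](subr0); apply: cvgB; first exact: cvgMr.
  exact: cvg_powR_expR.
Qed.

Lemma gamma_value1 : gamma_value 1 1.
Proof.
exists (fun t => 1 - expR (- t)); split.
- move=> t t0; apply: is_derive_eq.
  rewrite /gamma_integrand subrr powRr0 /GRing.scale/=; ring.
- by rewrite oppr0 expR0 subrr.
- rewrite -[X in _ --> X](subrr 1) -[X in _ --> _ - X]expR0 -[X in expR X]oppr0.
  apply: cvgB; first exact: cvg_cst.
  apply: cvg_at_right_filter; apply: continuous_comp; first exact: continuousN.
  exact: continuous_expR.
- rewrite -[X in _ --> X](subr0 1).
  apply: cvgB; [exact: cvg_cst | exact: cvgr_expR].
Qed.

(** The substitution [t = s^2] turns the integrand into a Gaussian, so twice the
    Gauss integral up to [sqrt t] is a primitive. *)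
Lemma gamma_value_half : gamma_value 2^-1 (Num.sqrt pi).
Proof.
pose g : R -> R := @gauss_integral_proof.integral0_gauss R.
have ig (b : R) : mu.-integrable `[0, b] (EFin \o gauss_fun).
  apply: continuous_compact_integrable => //; first exact: segment_compact.
  by apply: continuous_subspaceT; exact: continuous_gauss_fun.
have dg (s : R) : 0 < s -> is_derive s 1 g (gauss_fun s).
  move=> s0; have [||||dgs <-] := @continuous_FTC1 R gauss_fun (BLeft 0) s (s + 1).
  - by rewrite ltrDl.
  - exact: ig.
  - by rewrite /= lte_fin.
  - exact: continuous_gauss_fun.
  - by rewrite derive1E; apply/derivableP.
exists (fun t => 2 * g (Num.sqrt t)); split.
- move=> t t0; have s0 : 0 < Num.sqrt t by rewrite sqrtr_gt0.
  have ds := is_derive1_sqrt t0.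
  have dgt := dg _ s0.
  have dc := is_derive1_comp dgt ds.
  apply: is_derive_eq.
  rewrite /gauss_fun sqr_sqrtr ?ltW// /gamma_integrand /GRing.scale/=.
  rewrite (_ : 2^-1 - 1 = - 2^-1); last by lra.
  rewrite powRN powR12_sqrt ?ltW// invfM.
  by field; rewrite gt_eqF.
- rewrite sqrtr0 /g /gauss_integral_proof.integral0_gauss set_itv1 Rintegral_set1.
  by rewrite mulr0.
- rewrite -[X in _ --> X](mulr0 2); apply: cvgMr.
  apply: (@cvg_comp _ _ _ (@Num.sqrt R) g _ (nbhs (0 : R))).
    by have /cvg_at_right_filter := @sqrt_continuous R 0; rewrite sqrtr0.
  exact: (@parameterized_integral_cvg_left _ 0 1 gauss_fun).
- rewrite (_ : Num.sqrt pi = 2 * (Num.sqrt pi / 2)); last by field.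
  apply: cvgMr; apply: (@cvg_comp _ _ _ (@Num.sqrt R) g _ (pinfty_nbhs R)).
    apply/cvgryPge => A; near=> t; apply: le_trans (ler_norm A) _.
    rewrite -sqrtr_sqr ler_wsqrtr//; near: t; apply: nbhs_pinfty_ge.
  have : Num.sqrt (g t ^+ 2) @[t --> +oo] --> Num.sqrt (pi / 4).
    apply: continuous_cvg; first exact: sqrt_continuous.
    exact: gauss_integral_proof.cvg_integral0_gauss_sqr.
  rewrite sqrtrM ?pi_ge0// sqrtrV// (_ : 4 = 2 ^+ 2); last by rewrite expr2 -natrM.
  rewrite sqrtr_sqr ger0_norm// (_ : (fun _ => Num.sqrt _) = g)//.
  apply/funext => r; rewrite sqrtr_sqr ger0_norm//.
  exact: gauss_integral_proof.integral0_gauss_ge0.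
Unshelve. all: by end_near. Qed.

Lemma gamma_integrand_ge0 x t : 0 <= gamma_integrand x t.
Proof. by rewrite mulr_ge0 ?powR_ge0 ?expR_ge0. Qed.

Lemma continuous_gamma_integrand x : 1 < x ->
  {within `[0, +oo[, continuous (gamma_integrand x)}.
Proof.
move=> x1; apply/continuous_within_itvcyP; split.
  move=> t; rewrite in_itv/= andbT => t0.
  apply: differentiable_continuous; apply/derivable1_diffP.
  have dx := is_derive1_powR (x - 1) t0.
  exact: ex_derive.
rewrite /gamma_integrand powR0 ?subr_eq0 ?gt_eqF//.
apply: cvgM; first by apply: powR_cvg0; rewrite subr_gt0.
apply: cvg_at_right_filter; apply: continuous_comp; first exact: continuousN.
exact: continuous_expR.
Qed.

Lemma measurable_gamma_integrand x : 1 < x ->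
  measurable_fun `](0 : R), +oo[ (EFin \o gamma_integrand x).
Proof.
move=> x1; apply/measurable_EFinP; apply: open_continuous_measurable_fun => //.
have /continuous_within_itvcyP[cf _] := continuous_gamma_integrand x1.
exact/in_continuous_mksetP.
Qed.

(** The restriction to [1 < x] makes the integrand continuous up to 0, as the
    fundamental theorem of calculus on a half-line requires. *)
Lemma gamma_integral x L : 1 < x -> gamma_value x L ->
  (\int[mu]_(t in `]0%R, +oo[) (gamma_integrand x t)%:E = L%:E)%E.
Proof.
move=> x1 [P [dP P0 P0r Py]].
rewrite integral_itv_obnd_cbnd; last exact: measurable_gamma_integrand.
rewrite (ge0_continuous_FTC2y (F := P) (l := L)) ?P0 ?sube0//.
- by move=> t _; exact: gamma_integrand_ge0.
- exact: continuous_gamma_integrand.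
- by move=> t t0; case: (dP t t0).
- by move=> t; rewrite in_itv/= andbT => t0; rewrite derive1E; case: (dP t t0).
Qed.

Lemma gamma_integrable x L : 1 < x -> gamma_value x L ->
  mu.-integrable `]0, +oo[ (EFin \o gamma_integrand x).
Proof.
move=> x1 xL; apply/integrableP; split; first exact: measurable_gamma_integrand.
under eq_integral do rewrite /= ger0_norm ?gamma_integrand_ge0//.
by rewrite (gamma_integral x1 xL) ltry.
Qed.

Lemma gamma_valueE x L : 1 < x -> gamma_value x L -> Gamma x = L.
Proof. by move=> x1 xL; rewrite /Gamma /Rintegral (gamma_integral x1 xL). Qed.

(** Cauchy-Schwarz: the quadratic polynomial in [c] given by the integral of
    [t^(x-1) e^(-t) (sqrt t - c)^2] has no negative value; the choice
    [c = L1 / L] minimizes it. *)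
Lemma Gamma_half_step_log_convex x L L1 L2 : 1 < x -> 0 < L ->
  gamma_value x L -> gamma_value (x + 2^-1) L1 -> gamma_value (x + 1) L2 ->
  L1 ^+ 2 <= L * L2.
Proof.
move=> x1 L0 gL gL1 gL2.
have i0 := gamma_integrable x1 gL.
have y1 : 1 < x + 2^-1 by lra.
have z1 : 1 < x + 1 by lra.
have i1 := gamma_integrable y1 gL1.
have i2 := gamma_integrable z1 gL2.
suff H c : 0 <= L2 - 2 * c * L1 + c ^+ 2 * L.
  have := H (L1 / L).
  rewrite (_ : L2 - _ + _ = (L * L2 - L1 ^+ 2) / L); last by field; rewrite gt_eqF.
  by rewrite pmulr_lge0 ?invr_gt0// subr_ge0.
have : 0 <= \int[mu]_(t in `]0, +oo[)
    (gamma_integrand (x + 1) t + - (2 * c) * gamma_integrand (x + 2^-1) t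
     + c ^+ 2 * gamma_integrand x t).
  apply: Rintegral_ge0 => t /=; rewrite in_itv/= andbT => t0.
  rewrite (_ : _ + _ = gamma_integrand x t * (Num.sqrt t - c) ^+ 2).
    by rewrite mulr_ge0 ?gamma_integrand_ge0 ?sqr_ge0.
  rewrite /gamma_integrand (_ : x + 1 - 1 = 1 + (x - 1)); last by ring.
  rewrite (_ : x + 2^-1 - 1 = 2^-1 + (x - 1)); last by ring.
  rewrite !powRD ?(gt_eqF t0) ?implybT// powR12_sqrt ?ltW// powRr1 ?ltW//.
  rewrite -{1}(sqr_sqrtr (ltW t0)); ring.
have iZ (k : R) y : mu.-integrable `]0, +oo[ (EFin \o gamma_integrand y) ->
    mu.-integrable `]0, +oo[ (EFin \o (fun t => k * gamma_integrand y t)).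
  by move=> iy; apply: (integrableZl _ k iy).
rewrite RintegralD//; last 2 first.
- by apply: (integrableD _ i2 (iZ _ _ i1)).
- exact: iZ.
rewrite RintegralD//; last exact: iZ.
rewrite !RintegralZl//.
rewrite -!/(Gamma _) (gamma_valueE x1 gL) (gamma_valueE y1 gL1).
by rewrite (gamma_valueE z1 gL2) mulNr.
Qed.

End gamma_value.

(** * Logarithms *)

Section log_bounds.
Context {R : realType}.
Implicit Types (a b u v p q : R) (f df : R -> R) (n : nat).

Lemma ge0_of_derive_ge0 f df :
  (forall u, 1 <= u -> is_derive u 1 f (df u)) ->
  (forall u, 1 <= u -> 0 <= df u) -> f 1 = 0 ->
  forall u, 1 <= u -> 0 <= f u.
Proof.
move=> fdf df0 f1 u u1; rewrite -f1.
have in1 x : x \in `]1, +oo[%R -> 1 <= x by rewrite in_itv/= andbT; apply: ltW.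
apply: (@ger0_derive1_ndecry R f 1) => //.
- by move=> x /in1 /fdf [].
- by move=> x /in1 x1; rewrite derive1E; have [_ ->] := fdf _ x1; exact: df0.
- apply: derivable_within_continuous => x.
  by rewrite in_itv/= andbT => /fdf [].
Qed.

Lemma ln_le_sub1 u : 0 < u -> ln u <= u - 1.
Proof.
by move=> u0; have := @le_ln1Dx R (u - 1); rewrite subrKC; apply; lra.
Qed.

Lemma ln_ge_sub1 u : 0 < u -> 1 - u^-1 <= ln u.
Proof.
move=> u0; have u0' : 0 < u^-1 by rewrite invr_gt0.
by have := ln_le_sub1 u0'; rewrite lnV ?posrE//; lra.
Qed.

(** Both this bound and the next one are exact to second order in [b - a], which
    is the precision that the comparison of [h n] with [h (n + 1)] requires.
    They say that two functions of [u = b / a] vanishing at [u = 1] are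
    increasing; multiplying by the denominator beforehand keeps quotients out of
    the derivatives. *)
Lemma ln_diff_ge a b : 0 < a -> a <= b ->
  2 * (b - a) / (a + b) <= ln b - ln a.
Proof.
move=> a0 ab; have b0 : 0 < b by apply: lt_le_trans ab.
rewrite -ln_div ?posrE//.
have u1 : 1 <= b / a by rewrite ler_pdivlMr// mul1r.
have := @ge0_of_derive_ge0 (fun u => (u + 1) * ln u - 2 * (u - 1))
  (fun u => ln u + (u + 1) / u - 2) _ _ _ _ u1.
rewrite ler_pdivrMr ?addr_gt0// => H.
rewrite -subr_ge0.
rewrite (_ : _ - _ = a * ((b / a + 1) * ln (b / a) - 2 * (b / a - 1))).
  apply: mulr_ge0; first exact: ltW.
  apply: H.
  - move=> u u0; have {}u0 : 0 < u by lra.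
    have dl := is_derive1_ln u0.
    apply: is_derive_eq; rewrite /GRing.scale/=; ring.
  - move=> u u0; have {}u0 : 0 < u by lra.
    have := ln_ge_sub1 u0; rewrite mulrDl divff ?gt_eqF//; lra.
  - by rewrite ln1; ring.
by field; rewrite gt_eqF.
Qed.

Lemma ln_diff_le a b : 0 < a -> a <= b ->
  ln b - ln a <= (b - a) * (a + b) / (2 * a * b).
Proof.
move=> a0 ab; have b0 : 0 < b by apply: lt_le_trans ab.
rewrite -ln_div ?posrE//.
have u1 : 1 <= b / a by rewrite ler_pdivlMr// mul1r.
have := @ge0_of_derive_ge0 (fun u => u * u - 1 - 2 * (u * ln u))
  (fun u => 2 * (u - 1 - ln u)) _ _ _ _ u1.
rewrite ler_pdivlMr ?mulr_gt0// => H.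
rewrite -subr_ge0.
rewrite (_ : _ - _ = a ^+ 2 * (b / a * (b / a) - 1 - 2 * (b / a * ln (b / a)))).
  apply: mulr_ge0; first exact: sqr_ge0.
  apply: H.
  - move=> u u0; have {}u0 : 0 < u by lra.
    have dl := is_derive1_ln u0.
    apply: is_derive_eq; rewrite /GRing.scale/=; field; lra.
  - move=> u u0; have {}u0 : 0 < u by lra.
    have := ln_le_sub1 u0; lra.
  - by rewrite ln1; ring.
by field; rewrite gt_eqF.
Qed.

Lemma ln_smooth (a b c d e : nat) :
  ln (2 ^+ a * 3 ^+ b * 5 ^+ c * 7 ^+ d * 11 ^+ e) =
  a%:R * ln 2 + b%:R * ln 3 + c%:R * ln 5 + d%:R * ln 7 + e%:R * ln 11 :> R.
Proof.
by rewrite !lnM ?posrE ?mulr_gt0 ?exprn_gt0// !lnXn// !mulr_natl.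
Qed.

(** Every numerical comparison below is an inequality between two integers read
    through this lemma; the prime 11 occurs only in the lower bound for [pi]. *)
Lemma ltr_ln_smooth (a b c d e a' b' c' d' e' : nat) :
  2 ^+ a * 3 ^+ b * 5 ^+ c * 7 ^+ d * 11 ^+ e <
  2 ^+ a' * 3 ^+ b' * 5 ^+ c' * 7 ^+ d' * 11 ^+ e' :> R ->
  a%:R * ln 2 + b%:R * ln 3 + c%:R * ln 5 + d%:R * ln 7 + e%:R * ln 11 <
  a'%:R * ln 2 + b'%:R * ln 3 + c'%:R * ln 5 + d'%:R * ln 7 + e'%:R * ln 11 :> R.
Proof. by rewrite -!ln_smooth ltr_ln ?posrE ?mulr_gt0 ?exprn_gt0. Qed.

Definition lnn n : R := ln n%:R.

Lemma lnn_smooth (a b c d e : nat) :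
  lnn (2 ^ a * 3 ^ b * 5 ^ c * 7 ^ d * 11 ^ e) =
  a%:R * ln 2 + b%:R * ln 3 + c%:R * ln 5 + d%:R * ln 7 + e%:R * ln 11.
Proof. by rewrite -ln_smooth /lnn !natrM !natrX. Qed.

Lemma lnn4 : lnn 4 = 2 * ln 2.
Proof. by have := lnn_smooth 2 0 0 0 0; rewrite /lnn /=; lra. Qed.

Lemma lnn6 : lnn 6 = ln 2 + ln 3.
Proof. by have := lnn_smooth 1 1 0 0 0; rewrite /lnn /=; lra. Qed.

Lemma lnn8 : lnn 8 = 3 * ln 2.
Proof. by have := lnn_smooth 3 0 0 0 0; rewrite /lnn /=; lra. Qed.

Lemma lnn9 : lnn 9 = 2 * ln 3.
Proof. by have := lnn_smooth 0 2 0 0 0; rewrite /lnn /=; lra. Qed.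

Lemma lnn10 : lnn 10 = ln 2 + ln 5.
Proof. by have := lnn_smooth 1 0 1 0 0; rewrite /lnn /=; lra. Qed.

Lemma lnn_double_step n :
  2 / (n%:R + 3) <= lnn n.+4 - lnn n.+2
    <= 2 * (n%:R + 3) / ((n%:R + 2) * (n%:R + 4)).
Proof.
have y0 : 0 <= n%:R :> R by [].
have e2 : n.+2%:R = n%:R + 2 :> R by rewrite -addn2 natrD.
have e4 : n.+4%:R = n%:R + 4 :> R by rewrite -addn4 natrD.
have a0 : 0 < n%:R + 2 :> R by lra.
have ab : n%:R + 2 <= n%:R + 4 :> R by lra.
have := ln_diff_ge a0 ab; have := ln_diff_le a0 ab.
rewrite /lnn e2 e4; move: (ln _) (ln _) => lb la; move: (n%:R) y0 => y y0 hi lo.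
apply/andP; split.
  by apply: le_trans lo; rewrite [leRHS](_ : _ = 2 / (y + 3)); [|field; lra].
apply: le_trans hi _.
by rewrite [leLHS](_ : _ = 2 * (y + 3) / ((y + 2) * (y + 4))); [|field; lra].
Qed.

Lemma lnn_single_step n :
  2 / (2 * n%:R + 5) <= lnn n.+3 - lnn n.+2
    <= (2 * n%:R + 5) / (2 * (n%:R + 2) * (n%:R + 3)).
Proof.
have y0 : 0 <= n%:R :> R by [].
have e2 : n.+2%:R = n%:R + 2 :> R by rewrite -addn2 natrD.
have e3 : n.+3%:R = n%:R + 3 :> R by rewrite -addn3 natrD.
have a0 : 0 < n%:R + 2 :> R by lra.
have ab : n%:R + 2 <= n%:R + 3 :> R by lra.
have := ln_diff_ge a0 ab; have := ln_diff_le a0 ab.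
rewrite /lnn e2 e3; move: (ln _) (ln _) => lb la; move: (n%:R) y0 => y y0 hi lo.
apply/andP; split.
  by apply: le_trans lo; rewrite [leRHS](_ : _ = 2 / (2 * y + 5)); [|field; lra].
apply: le_trans hi _.
rewrite [leLHS](_ : _ = (2 * y + 5) / (2 * (y + 2) * (y + 3))) //.
by field; lra.
Qed.

Lemma lnn_double_step_decr n : lnn n.+4.+2 - lnn n.+4 <= lnn n.+4 - lnn n.+2.
Proof.
have [+ _] := andP (lnn_double_step n); have [_ +] := andP (lnn_double_step n.+2).
rewrite (_ : n.+2%:R = n%:R + 2); last by rewrite -addn2 natrD.
have y0 : 0 <= n%:R :> R by [].
move=> H1 H2; apply: le_trans H1 (le_trans _ H2); rewrite -subr_ge0.
rewrite (_ : _ - _ = 2 * (2 * n%:R + 9) / ((n%:R + 3) * (n%:R + 4) * (n%:R + 6))).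
  by rewrite divr_ge0 ?mulr_ge0//; lra.
by field; lra.
Qed.

(** This is the growth of [t |-> t ln (1 + 1/t)], at [t = (n + 2) / 2]. *)
Lemma lnn_double_step_incr n :
  (n%:R + 2) * (lnn n.+4 - lnn n.+2) <= (n%:R + 4) * (lnn n.+4.+2 - lnn n.+4).
Proof.
have [_ H1] := andP (lnn_double_step n); have [H2 _] := andP (lnn_double_step n.+2).
move: H2; rewrite (_ : n.+2%:R = n%:R + 2); last by rewrite -addn2 natrD.
have y0 : 0 <= n%:R :> R by [].
set y := n%:R in y0 H1 * => H2.
have y2 : 0 < y + 2 by lra.
have y4 : 0 < y + 4 by lra.
rewrite -(ler_pM2l y2) in H1; rewrite -(ler_pM2l y4) in H2.
apply: le_trans H1 (le_trans _ H2); rewrite -subr_ge0.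
rewrite (_ : _ - _ = 2 / ((y + 4) * (y + 5))).
  by rewrite divr_ge0 ?mulr_ge0//; lra.
by field; lra.
Qed.

Lemma ltr_of_ln u v : 0 < u -> 0 < v -> ln u < ln v -> u < v.
Proof. by move=> u0 v0; rewrite ltr_ln. Qed.

Lemma ln_powR_div u v p q a b : 0 < u -> 0 < v -> ln u = a -> ln v = b ->
  ln (u `^ p / v `^ q) = p * a - q * b.
Proof. by move=> u0 v0 <- <-; rewrite ln_div ?posrE ?powR_gt0// !ln_powR. Qed.

Lemma ln_sqrt u : 0 <= u -> ln (Num.sqrt u) = ln u / 2.
Proof. by move=> u0; rewrite -powR12_sqrt// ln_powR mulrC. Qed.

Lemma ln_ratio24 n : ln ((n%:R + 2) / (n%:R + 4)) = - (lnn n.+4 - lnn n.+2).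
Proof.
have n0 : 0 <= n%:R :> R by [].
rewrite ln_div ?posrE; [|lra|lra].
by rewrite opprB /lnn -[n.+4]addn4 -[n.+2]addn2 !natrD.
Qed.

Lemma ln_ratio23 n : ln ((n%:R + 2) / (n%:R + 3)) = - (lnn n.+3 - lnn n.+2).
Proof.
have n0 : 0 <= n%:R :> R by [].
rewrite ln_div ?posrE; [|lra|lra].
by rewrite opprB /lnn -[n.+3]addn3 -[n.+2]addn2 !natrD.
Qed.

End log_bounds.

(** * Logarithms of the gamma function at half-integers *)

Section log_Gamma_half.
Context {R : realType}.
Implicit Types n : nat.

(** Positive values propagate from [Gamma 1] and [Gamma (1/2)] by the functional
    equation, through integers and half-odd integers respectively. *)
Lemma gamma_value_half_integer n :
  exists2 L : R, 0 < L & gamma_value (1 + n%:R / 2) L.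
Proof.
suff [] : (exists2 L : R, 0 < L & gamma_value (1 + n%:R / 2) L) /\
          (exists2 L : R, 0 < L & gamma_value (1 + n.+1%:R / 2) L) by [].
elim: n => [|n [Hn Hn1]].
  split; first by exists 1 => //; rewrite mul0r addr0; exact: gamma_value1.
  exists (2^-1 * Num.sqrt pi).
    by rewrite mulr_gt0 ?invr_gt0 ?sqrtr_gt0 ?pi_gt0.
  rewrite addrC mul1r; apply: gamma_valueS; first by rewrite invr_gt0.
  exact: gamma_value_half.
split=> //; case: Hn => L L0 gL.
have x0 : 0 < 1 + n%:R / 2 :> R by rewrite ltr_pwDl// divr_ge0.
exists ((1 + n%:R / 2) * L); first exact: mulr_gt0.
rewrite (_ : 1 + n.+2%:R / 2 = 1 + n%:R / 2 + 1); first exact: gamma_valueS.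
by rewrite -(addn2 n) natrD; field.
Qed.

Let one_lt n : (0 < n)%N -> 1 < 1 + n%:R / 2 :> R.
Proof. by move=> n0; rewrite ltrDl divr_gt0// ltr0n. Qed.

Lemma Gamma_half_gt0 n : (0 < n)%N -> 0 < Gamma (1 + n%:R / 2) :> R.
Proof.
move=> n0; have [L L0 gL] := gamma_value_half_integer n.
by rewrite (gamma_valueE (one_lt n0) gL).
Qed.

Definition log_Gamma_half n : R := ln (Gamma (1 + n%:R / 2)).
Local Notation h := log_Gamma_half.
Local Notation l := (@lnn R).

Lemma log_Gamma_half1 : h 1 = ln pi / 2 - ln 2.
Proof.
have gL : gamma_value (2^-1 + 1 : R) (2^-1 * Num.sqrt pi).
  by apply: gamma_valueS; [rewrite invr_gt0 | exact: gamma_value_half].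
rewrite /h mul1r addrC (gamma_valueE _ gL); last by lra.
rewrite lnM ?posrE ?invr_gt0 ?sqrtr_gt0 ?pi_gt0// lnV ?posrE//.
by rewrite -powR12_sqrt ?pi_ge0// ln_powR; ring.
Qed.

Lemma log_Gamma_half2 : h 2 = 0.
Proof.
have gL : gamma_value (1 + 1 : R) (1 * 1) by apply: gamma_valueS gamma_value1.
rewrite /h divff// (gamma_valueE _ gL); last by lra.
by rewrite mulr1 ln1.
Qed.

Lemma log_Gamma_halfSS n : (0 < n)%N -> h n.+2 = h n + l n.+2 - l 2.
Proof.
move=> n0; have [L L0 gL] := gamma_value_half_integer n.
have x0 : 0 < 1 + n%:R / 2 :> R by rewrite (lt_trans ltr01)// one_lt.
have gS := gamma_valueS x0 gL.
have e : 1 + n.+2%:R / 2 = 1 + n%:R / 2 + 1 :> R.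
  by rewrite -(addn2 n) natrD; field.
rewrite /h e (gamma_valueE _ gS); last by rewrite -e one_lt.
rewrite (gamma_valueE (one_lt n0) gL) lnM ?posrE// addrC -addrA; congr (_ + _).
rewrite /lnn -ln_div ?posrE ?ltr0n//; congr ln.
by rewrite -(addn2 n) natrD; field.
Qed.

(* The condition 0 < n is absorbed into the index, so that repeated rewriting
   stops at h 1 and h 2. *)
Let hS3 n : h n.+3 = h n.+1 + l n.+3 - l 2.
Proof. exact: log_Gamma_halfSS. Qed.

Lemma log_Gamma_half_convex n : (0 < n)%N -> 2 * h n.+1 <= h n + h n.+2.
Proof.
move=> n0; have [L L0 gL] := gamma_value_half_integer n.
have [L1 L10 gL1] := gamma_value_half_integer n.+1.
have [L2 L20 gL2] := gamma_value_half_integer n.+2.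
rewrite /h (gamma_valueE (one_lt n0) gL) (gamma_valueE (one_lt (ltn0Sn _)) gL1).
rewrite (gamma_valueE (one_lt (ltn0Sn _)) gL2).
rewrite mulr_natl -lnXn// -lnM ?posrE// ler_ln ?posrE ?exprn_gt0 ?mulr_gt0//.
apply: (Gamma_half_step_log_convex (one_lt n0) L0 gL).
- move: gL1; rewrite (_ : 1 + n.+1%:R / 2 = 1 + n%:R / 2 + 2^-1)//.
  by rewrite -addn1 natrD; field.
- move: gL2; rewrite (_ : 1 + n.+2%:R / 2 = 1 + n%:R / 2 + 1)//.
  by rewrite -addn2 natrD; field.
Qed.

(** Wallis: [Gamma 6 ^ 2 <= Gamma (11/2) * Gamma (13/2)] reads
    [2^17 / (3^4 * 7^2 * 11) <= pi]. *)
Lemma lnpi_gt : ln 3 < ln pi :> R.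
Proof.
have := log_Gamma_half_convex (n := 9) isT.
rewrite !hS3 log_Gamma_half1 log_Gamma_half2 lnn4 lnn6 lnn8 lnn9 lnn10 /lnn.
have := @ltr_ln_smooth R 0 5 0 2 1 17 0 0 0 0.
lra.
Qed.

(** Likewise [Gamma (7/2) ^ 2 <= Gamma 3 * Gamma 4] reads [pi <= 256 / 75]. *)
Lemma lnpi_le : ln pi <= 8 * ln 2 - ln 3 - 2 * ln 5 :> R.
Proof.
have := log_Gamma_half_convex (n := 4) isT.
rewrite !hS3 log_Gamma_half1 log_Gamma_half2 lnn4 lnn6 /lnn.
lra.
Qed.

(** * Bounds by induction in steps of two *)

Lemma gt0_two_step (f : nat -> R) m : 0 < f m -> 0 < f m.+1 ->
  (forall n, (m <= n)%N -> f n <= f n.+2) ->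
  forall n, (m <= n)%N -> 0 < f n.
Proof.
move=> fm fm1 step n /subnK <-; elim/ltn_ind: (n - m)%N => -[|[|k]] IH //.
by apply: lt_le_trans (step _ _); [apply: IH | exact: leq_addl].
Qed.

Let eq_ge0 (a b : R) : 0 <= a -> b = a -> 0 <= b.
Proof. by move=> a0 ->. Qed.

Let natrSS n : n.+2%:R = n%:R + 2 :> R.
Proof. by rewrite -addn2 natrD. Qed.

(** From [n] to [n + 2] the difference of the two sides grows by
    [(n + 2) / 2 * ((n + 4) D (n + 2) - (n + 2) D n)]. *)
Lemma log_Gamma_half_gt n : (0 < n)%N ->
  n%:R * (l n.+2 - l 2) - n%:R * (n%:R + 2) / 2 * (l n.+4 - l n.+2) < 2 * h n.
Proof.
rewrite -subr_gt0; move: n; apply: gt0_two_step.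
- rewrite log_Gamma_half1 /lnn.
  have := lnpi_gt; have := @ltr_ln_smooth R 2 3 0 0 0 0 0 3 0 0; lra.
- rewrite log_Gamma_half2 lnn4 lnn6 /lnn.
  have := @ltr_ln_smooth R 6 0 0 0 0 0 4 0 0 0; lra.
- move=> n n0; rewrite log_Gamma_halfSS// -subr_ge0.
  have := @lnn_double_step_incr R n.
  rewrite (natrSS n) -subr_ge0; set y := n%:R => H.
  have y0 : 0 <= y by [].
  have c0 : 0 <= (y + 2) / 2 by lra.
  by apply: (eq_ge0 (mulr_ge0 c0 H)); field.
Qed.

(** Here the growth is [(n + 2) (n + 4) / 4 * (D n - D (n + 2))]. *)
Lemma log_Gamma_half_lt n : (0 < n)%N ->
  2 * h n < n%:R * (l n.+2 - l 2) - n%:R * (n%:R + 2) / 4 * (l n.+4 - l n.+2).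
Proof.
rewrite -subr_gt0; move: n; apply: gt0_two_step.
- rewrite log_Gamma_half1 /lnn.
  have := lnpi_le; have := @ltr_ln_smooth R 28 0 0 0 0 0 11 5 0 0; lra.
- rewrite log_Gamma_half2 lnn4 lnn6 /lnn.
  have := @ltr_ln_smooth R 0 2 0 0 0 4 0 0 0 0; lra.
- move=> n n0; rewrite log_Gamma_halfSS// -subr_ge0.
  have := @lnn_double_step_decr R n.
  rewrite (natrSS n) -subr_ge0; set y := n%:R => H.
  have y0 : 0 <= y by [].
  have c0 : 0 <= (y + 2) * (y + 4) / 4 by rewrite divr_ge0 ?mulr_ge0//; lra.
  by apply: (eq_ge0 (mulr_ge0 c0 H)); field.
Qed.

(** For [n = 2] both sides vanish, and for [n = 1] the inequality is reversed.
    The growth is [n / 2 * ((n + 2) D (n + 2) - n D n)]. *)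
Lemma log_Gamma_half_gt_shift n : (3 <= n)%N ->
  (n%:R - 2) * (l n.+2 - l 2) - n%:R * (n%:R - 2) / 2 * (l n.+4 - l n.+2)
    < 2 * h n.
Proof.
rewrite -subr_gt0; move: n; apply: gt0_two_step.
- rewrite hS3 log_Gamma_half1 /lnn.
  have := lnpi_gt; have := @ltr_ln_smooth R 6 0 5 0 0 0 6 0 3 0; lra.
- rewrite hS3 log_Gamma_half2 lnn4 lnn6 lnn8 /lnn.
  have := @ltr_ln_smooth R 0 6 0 0 0 10 0 0 0 0; lra.
- move=> n n3; rewrite log_Gamma_halfSS ?(leq_trans _ n3)// -subr_ge0.
  have := @lnn_double_step_incr R n; have := @lnn_double_step_decr R n.
  rewrite (natrSS n).
  have y0 : 0 <= n%:R :> R by [].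
  set y := n%:R in y0 * => H1 H2.
  have H : 0 <= (y + 2) * (l n.+4.+2 - l n.+4) - y * (l n.+4 - l n.+2) by lra.
  have c0 : 0 <= y / 2 by lra.
  by apply: (eq_ge0 (mulr_ge0 c0 H)); field.
Qed.

(** Here the growth is [n / 8 * ((n + 6) D n - (n + 2) D (n + 2))]. *)
Lemma log_Gamma_half_lt_shift n : (3 <= n)%N ->
  2 * h n
    < (n%:R - 2) * (l n.+2 - l 2) - n%:R * (n%:R - 2) / 8 * (l n.+4 - l n.+2).
Proof.
rewrite -subr_gt0; move: n; apply: gt0_two_step.
- rewrite hS3 log_Gamma_half1 /lnn.
  have := lnpi_le; have := @ltr_ln_smooth R 40 8 0 3 0 0 0 27 0 0; lra.
- rewrite hS3 log_Gamma_half2 lnn4 lnn6 lnn8 /lnn.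
  have := @ltr_ln_smooth R 4 0 0 0 0 0 3 0 0 0; lra.
- move=> n n3; rewrite log_Gamma_halfSS ?(leq_trans _ n3)// -subr_ge0.
  have := @lnn_double_step_decr R n; have [D0 _] := andP (@lnn_double_step R n).
  rewrite (natrSS n).
  have y0 : 0 <= n%:R :> R by [].
  set y := n%:R in y0 D0 * => H1.
  have {}D0 : 0 <= l n.+4 - l n.+2 by apply: le_trans D0; rewrite divr_ge0//; lra.
  have H : 0 <= (y + 6) * (l n.+4 - l n.+2) - (y + 2) * (l n.+4.+2 - l n.+4).
    by nra.
  have c0 : 0 <= y / 8 by lra.
  by apply: (eq_ge0 (mulr_ge0 c0 H)); field.
Qed.

(** The increment from [n = y] to [n = y + 2] of the difference of the two sides
    in [log_Gamma_half_gt_single], with each logarithm replaced by the rational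
    bound of [lnn_single_step] in the unfavourable direction. *)
Lemma gt_single_increment_ge0 (y : R) : 1 <= y ->
  0 <= (y + 2) * (y + 3) * (2 / (2 * (y + 2) + 5)) -
       (y + 2) * ((2 * (y + 1) + 5) / (2 * (y + 1 + 2) * (y + 1 + 3))) -
       (y ^+ 2 + 2 * y + 2) * ((2 * y + 5) / (2 * (y + 2) * (y + 3))).
Proof.
move=> y1; have y0 : 0 <= y by lra.
rewrite (_ : _ - _ = (7 * y ^+ 3 + 43 * y ^+ 2 + 50 * y - 36) /
       (2 * (2 * y + 9) * (y + 2) * (y + 3) * (y + 4))); last by field; lra.
apply: divr_ge0; last by rewrite !mulr_ge0//; lra.
have := exprn_ge0 2 y0; have := exprn_ge0 3 y0; lra.
Qed.

(** The analogous increment for [log_Gamma_half_lt_single]. *)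
Lemma lt_single_increment_ge0 (y : R) : 0 <= y ->
  0 <= y * (2 / (2 * (y - 1) + 5)) +
       (y + 2 + y * (y + 1) / 2) * (2 / (2 * y + 5)) -
       (y + 2) * (y + 3) / 2 *
         ((2 * (y + 2) + 5) / (2 * (y + 2 + 2) * (y + 2 + 3))).
Proof.
move=> y0.
rewrite (_ : _ - _ =
  (16 * y ^+ 4 + 174 * y ^+ 3 + 647 * y ^+ 2 + 873 * y + 150) /
  (4 * (2 * y + 3) * (2 * y + 5) * (y + 4) * (y + 5))); last by field; lra.
apply: divr_ge0; last by rewrite !mulr_ge0//; lra.
have := exprn_ge0 2 y0; have := exprn_ge0 3 y0; have := exprn_ge0 4 y0; lra.
Qed.

(** By convexity this yields the upper bound of the third quotient.  It fails for
    [n <= 2], and for [n = 3] it holds so narrowly that it would need a lower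
    bound for [pi] better than 3.11, hence the start at 4. *)
Lemma log_Gamma_half_gt_single n : (4 <= n)%N ->
  n%:R * (l n.+2 - l 2) - n%:R * (n%:R + 1) * (l n.+3 - l n.+2) < 2 * h n.
Proof.
rewrite -subr_gt0; move: n; apply: gt0_two_step.
- rewrite hS3 log_Gamma_half2 lnn4 lnn6 /lnn.
  have := @ltr_ln_smooth R 9 12 0 0 0 0 0 0 10 0; lra.
- rewrite !hS3 log_Gamma_half1 lnn8 /lnn.
  have := lnpi_gt; have := @ltr_ln_smooth R 0 0 0 35 0 89 3 2 0 0; lra.
- move=> n n4; rewrite log_Gamma_halfSS ?(leq_trans _ n4)// -subr_ge0.
  have [_ U0] := andP (@lnn_single_step R n).
  have [_ U1] := andP (@lnn_single_step R n.+1).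
  have [L2 _] := andP (@lnn_single_step R n.+2).
  have y1 : 4 <= n%:R :> R by rewrite ler_nat.
  move: L2 U1; rewrite (natrSS n).
  rewrite (_ : n.+1%:R = n%:R + 1); last by rewrite natr1.
  set y := n%:R in y1 U0 *.
  set a := l n.+3 - _ in U0 *; set b := l n.+4 - _; set c := l n.+4.+1 - _ => L2 U1.
  pose P := (y + 2) * (y + 3) * c - (y + 2) * b - (y ^+ 2 + 2 * y + 2) * a.
  have P0 : 0 <= P.
    have A : (y ^+ 2 + 2 * y + 2) * a <=
        (y ^+ 2 + 2 * y + 2) * ((2 * y + 5) / (2 * (y + 2) * (y + 3))).
      by apply: ler_wpM2l U0; nra.
    have B : (y + 2) * b <=
        (y + 2) * ((2 * (y + 1) + 5) / (2 * (y + 1 + 2) * (y + 1 + 3))).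
      by apply: ler_wpM2l U1; lra.
    have C : (y + 2) * (y + 3) * (2 / (2 * (y + 2) + 5)) <= (y + 2) * (y + 3) * c.
      by apply: ler_wpM2l L2; nra.
    have y_ge1 : 1 <= y by lra.
    by rewrite /P; have := gt_single_increment_ge0 y_ge1; lra.
  by apply: (eq_ge0 P0); rewrite /P /a /b /c; field.
Qed.

(** By convexity this yields the lower bound of the third quotient; it fails for
    [n = 1]. *)
Lemma log_Gamma_half_lt_single n : (2 <= n)%N ->
  2 * h n < n%:R * (l n.+1 - l 2) - n%:R * (n%:R + 1) / 2 * (l n.+3 - l n.+2).
Proof.
rewrite -subr_gt0; move: n; apply: gt0_two_step.
- rewrite log_Gamma_half2 lnn4 /lnn.
  have := @ltr_ln_smooth R 0 0 3 0 0 4 2 0 0 0; lra.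
- rewrite !hS3 log_Gamma_half1 lnn4 lnn6 /lnn.
  have := lnpi_le; have := @ltr_ln_smooth R 7 7 0 0 0 0 0 8 0 0; lra.
- move=> n n2; rewrite log_Gamma_halfSS ?(leq_trans _ n2)// -subr_ge0.
  have [L0 _] := andP (@lnn_single_step R n.-1).
  have [L1 _] := andP (@lnn_single_step R n).
  have [_ U2] := andP (@lnn_single_step R n.+2).
  have y1 : 2 <= n%:R :> R by rewrite ler_nat.
  move: L0 U2; rewrite (natrSS n).
  rewrite (_ : n.-1%:R = n%:R - 1); last by rewrite -subn1 natrB// (leq_trans _ n2).
  rewrite prednK ?(leq_trans _ n2)//.
  set y := n%:R in y1 L1 *.
  set a := l n.+2 - _; set b := l n.+3 - _ in L1 *; set c := l n.+4.+1 - _ => L0 U2.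
  pose P := y * (a + b) + 2 * b - ((y + 2) * (y + 3) * c - y * (y + 1) * b) / 2.
  have P0 : 0 <= P.
    have A : y * (2 / (2 * (y - 1) + 5)) <= y * a by apply: ler_wpM2l L0; lra.
    have B : (y + 2 + y * (y + 1) / 2) * (2 / (2 * y + 5)) <=
        (y + 2 + y * (y + 1) / 2) * b.
      by apply: ler_wpM2l L1; nra.
    have C : (y + 2) * (y + 3) / 2 * c <=
       (y + 2) * (y + 3) / 2 *
         ((2 * (y + 2) + 5) / (2 * (y + 2 + 2) * (y + 2 + 3))).
      by apply: ler_wpM2l U2; nra.
    have y_ge0 : 0 <= y by lra.
    by rewrite /P; have := lt_single_increment_ge0 y_ge0; lra.
  by apply: (eq_ge0 P0); rewrite /P /a /b /c; field.
Qed.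

(** * Consecutive and shifted quotients *)

(** Convexity at [n + 1] and the functional equation give
    [2 h (n + 1) - 2 h n <= ln ((n + 2) / 2)]; the cases [n <= 3] are explicit. *)
Lemma log_Gamma_half_single_lt n : (0 < n)%N ->
  n%:R * (2 * h n.+1) - (n%:R + 1) * (2 * h n) <
  n%:R * (n%:R + 1) * (l n.+3 - l n.+2).
Proof.
case: n => [//|[|[|[|n]]]] _.
- rewrite log_Gamma_half2 log_Gamma_half1 lnn4 /lnn.
  have := lnpi_gt; lra.
- rewrite hS3 log_Gamma_half2 log_Gamma_half1 lnn4 /lnn.
  have := lnpi_le; have := @ltr_ln_smooth R 10 1 0 0 0 0 0 5 0 0; lra.
- rewrite !hS3 log_Gamma_half2 log_Gamma_half1 lnn4 lnn6 /lnn.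
  have := lnpi_gt; have := @ltr_ln_smooth R 5 0 6 0 0 0 12 0 0 0; lra.
- have := @log_Gamma_half_gt_single n.+4 isT.
  have := @log_Gamma_half_convex n.+4 isT; rewrite (@log_Gamma_halfSS n.+4 isT).
  have : 0 <= n.+4%:R :> R by [].
  move: (n.+4%:R) (l n.+4.+2) (l 2) (l n.+4.+3) (h n.+4) (h n.+4.+1).
  move=> y l6 l2 l7 h4 h5 y0 H1 H2.
  have : 0 <= y * (2 * h4 + l6 - l2 - 2 * h5) by apply: mulr_ge0 => //; lra.
  lra.
Qed.

(** Convexity at [n] and the functional equation give
    [ln ((n + 1) / 2) <= 2 h (n + 1) - 2 h n]; the case [n = 1] is explicit. *)
Lemma log_Gamma_half_single_gt n : (0 < n)%N ->
  n%:R * (n%:R + 1) / 2 * (l n.+3 - l n.+2) <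
  n%:R * (2 * h n.+1) - (n%:R + 1) * (2 * h n).
Proof.
case: n => [//|[|n]] _.
- rewrite log_Gamma_half2 log_Gamma_half1 lnn4 /lnn.
  have := lnpi_le; have := @ltr_ln_smooth R 14 0 0 0 0 0 3 4 0 0; lra.
- have := @log_Gamma_half_lt_single n.+2 isT.
  have := @log_Gamma_half_convex n.+1 isT; rewrite hS3.
  have : 0 <= n.+2%:R :> R by [].
  move: (n.+2%:R) (l n.+3) (l 2) (l n.+4) (l n.+4.+1) (h n.+1) (h n.+2).
  move=> y l3 l2 l4 l5 h1 h2 y0 H1 H2.
  have : 0 <= y * (2 * h1 + l3 - l2 - 2 * h2) by apply: mulr_ge0 => //; lra.
  lra.
Qed.

(** Division by [n (n - 2)], which is negative for [n = 1], gives all [n] the same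
    direction of the inequalities. *)
Lemma log_Gamma_half_shift n : (0 < n)%N -> n <> 2%N ->
  - (l n.+4 - l n.+2) / 2 <
    (2 * h n - (n%:R - 2) * (l n.+2 - l 2)) / (n%:R * (n%:R - 2)) /\
  (2 * h n - (n%:R - 2) * (l n.+2 - l 2)) / (n%:R * (n%:R - 2)) <
    - (l n.+4 - l n.+2) / 8.
Proof.
case: n => [//|[_ _|[//|n] _ _]].
  rewrite (_ : 1%:R * (1%:R - 2) = -1 :> R); last by ring.
  rewrite invrN invr1 mulrN1 log_Gamma_half1 /lnn.
  have := lnpi_gt; have := lnpi_le.
  have := @ltr_ln_smooth R 10 1 0 0 0 0 0 5 0 0.
  have := @ltr_ln_smooth R 24 0 1 0 0 0 17 0 0 0.
  by move=> H1 H2 H3 H4; split; lra.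
have := @log_Gamma_half_gt_shift n.+3 isT.
have := @log_Gamma_half_lt_shift n.+3 isT.
have : 3 <= n.+3%:R :> R by rewrite ler_nat.
move: (n.+3%:R) (l n.+3.+2) (l 2) (l n.+3.+4) (h n.+3) => y a b c d y3 H1 H2.
have u0 : 0 < y * (y - 2) by apply: mulr_gt0; lra.
by rewrite ltr_pdivlMr// ltr_pdivrMr//; split; lra.
Qed.

(** * Logarithms of ratios of volumes *)

Lemma Omega_gt0 n : (0 < n)%N -> 0 < Omega R n.
Proof. by move=> n0; rewrite divr_gt0 ?powR_gt0 ?pi_gt0 ?Gamma_half_gt0. Qed.

Lemma ln_Omega n : (0 < n)%N -> ln (Omega R n) = n%:R / 2 * ln pi - h n.
Proof.
move=> n0; rewrite ln_div ?posrE ?powR_gt0 ?pi_gt0 ?Gamma_half_gt0//.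
by rewrite ln_powR.
Qed.

Lemma ln_OmegaSS n : (0 < n)%N ->
  ln (Omega R n.+2) = (n%:R + 2) / 2 * ln pi - (h n + l n.+2 - l 2).
Proof.
move=> n0; rewrite (ln_Omega (isT : 0 < n.+2)%N) (log_Gamma_halfSS n0).
by rewrite natrSS.
Qed.

Lemma ln_Omega_ratio2 n : (0 < n)%N ->
  - (l n.+4 - l n.+2) / 2
    < ln (Omega R n.+2 `^ (1 / (n%:R + 2)) / Omega R n `^ (1 / n%:R))
    < - (l n.+4 - l n.+2) / 4.
Proof.
move=> n0; have := log_Gamma_half_gt n0; have := log_Gamma_half_lt n0.
rewrite (ln_powR_div _ _ (Omega_gt0 (isT : 0 < n.+2)%N) (Omega_gt0 n0)
  (ln_OmegaSS n0) (ln_Omega n0)).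
have : 0 < n%:R :> R by rewrite ltr0n.
move: (n%:R) (l n.+4) (l n.+2) (l 2) (h n) (ln pi) => y c b a k p y0 hi lo.
rewrite (_ : 1 / _ * _ - _ = (2 * k - y * (b - a)) / (y * (y + 2))).
  have u0 : 0 < y * (y + 2) by apply: mulr_gt0; lra.
  by rewrite ltr_pdivlMr// ltr_pdivrMr//; apply/andP; split; lra.
by field; lra.
Qed.

Lemma ln_Omega_ratio_shift n : (0 < n)%N -> n <> 2%N ->
  - (l n.+4 - l n.+2) / 2
    < ln (Omega R n.+2 `^ (1 / n%:R) / Omega R n `^ (1 / (n%:R - 2)))
      + 2 / ((n%:R - 2) * n%:R) * ln pi
    < - (l n.+4 - l n.+2) / 8.
Proof.
move=> n0 n2; have [lo hi] := log_Gamma_half_shift n0 n2.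
rewrite (ln_powR_div _ _ (Omega_gt0 (isT : 0 < n.+2)%N) (Omega_gt0 n0)
  (ln_OmegaSS n0) (ln_Omega n0)).
have : n%:R != 0 :> R by rewrite pnatr_eq0 -lt0n.
have : n%:R - 2 != 0 :> R by rewrite subr_eq0 (eqr_nat R n 2); apply/eqP.
move: lo hi.
move: (n%:R) (l n.+4) (l n.+2) (l 2) (h n) (ln pi) => y c b a k p lo hi y2 y0.
rewrite (_ : 1 / _ * _ - _ + _ = (2 * k - (y - 2) * (b - a)) / (y * (y - 2))).
  by rewrite lo hi.
by field; rewrite y2 y0.
Qed.

Lemma ln_Omega_ratio1 n : (0 < n)%N ->
  - (l n.+3 - l n.+2) / 2
    < ln (Omega R n.+1 `^ (1 / (n%:R + 1)) / Omega R n `^ (1 / n%:R))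
    < - (l n.+3 - l n.+2) / 4.
Proof.
move=> n0; have := log_Gamma_half_single_lt n0.
have := log_Gamma_half_single_gt n0.
rewrite (ln_powR_div _ _ (Omega_gt0 (isT : 0 < n.+1)%N) (Omega_gt0 n0)
  (ln_Omega (isT : 0 < n.+1)%N) (ln_Omega n0)).
rewrite (_ : n.+1%:R = n%:R + 1); last by rewrite natr1.
have : 0 < n%:R :> R by rewrite ltr0n.
move: (n%:R) (l n.+3) (l n.+2) (h n) (h n.+1) (ln pi) => y c b k j p y0 hi lo.
rewrite (_ : 1 / _ * _ - _ = - (y * (2 * j) - (y + 1) * (2 * k)) / (2 * y * (y + 1))).
  have u0 : 0 < 2 * y * (y + 1) by apply: mulr_gt0; lra.
  by rewrite ltr_pdivlMr// ltr_pdivrMr//; apply/andP; split; lra.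
by field; lra.
Qed.

End log_Gamma_half.

Theorem theorem3 (R : realType) (n : nat) (n_gt0 : (0 < n)%N) :
  (Num.sqrt ((n%:R + 2) / (n%:R + 4))
     < Omega R (n + 2) `^ (1 / (n%:R + 2)) / Omega R n `^ (1 / n%:R)
   /\
   Omega R (n + 2) `^ (1 / (n%:R + 2)) / Omega R n `^ (1 / n%:R)
     < ((n%:R + 2) / (n%:R + 4)) `^ (1 / 4))
  /\
  (n <> 2%N ->
   1 / pi `^ (2 / ((n%:R - 2) * n%:R)) * Num.sqrt ((n%:R + 2) / (n%:R + 4))
     < Omega R (n + 2) `^ (1 / n%:R) / Omega R n `^ (1 / (n%:R - 2))
   /\
   Omega R (n + 2) `^ (1 / n%:R) / Omega R n `^ (1 / (n%:R - 2))
     < 1 / pi `^ (2 / ((n%:R - 2) * n%:R))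
       * ((n%:R + 2) / (n%:R + 4)) `^ (1 / 8))
  /\
  (Num.sqrt ((n%:R + 2) / (n%:R + 3))
     < Omega R (n + 1) `^ (1 / (n%:R + 1)) / Omega R n `^ (1 / n%:R)
   /\
   Omega R (n + 1) `^ (1 / (n%:R + 1)) / Omega R n `^ (1 / n%:R)
     < ((n%:R + 2) / (n%:R + 3)) `^ (1 / 4)).
Proof.
rewrite addn1 addn2.
have r24 : 0 < (n%:R + 2) / (n%:R + 4) :> R by rewrite divr_gt0 ?ltr_wpDl.
have r23 : 0 < (n%:R + 2) / (n%:R + 3) :> R by rewrite divr_gt0 ?ltr_wpDl.
have s24 := ln_sqrt (ltW r24); have s23 := ln_sqrt (ltW r23).
have q24 : 0 < Num.sqrt ((n%:R + 2) / (n%:R + 4)) :> R by rewrite sqrtr_gt0.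
have q23 : 0 < Num.sqrt ((n%:R + 2) / (n%:R + 3)) :> R by rewrite sqrtr_gt0.
have ratio_gt0 k p q : (0 < k)%N -> 0 < Omega R k `^ p / Omega R n `^ q.
  by move=> k0; rewrite divr_gt0 ?powR_gt0 ?Omega_gt0.
split; [|split].
- have /andP[lo hi] := @ln_Omega_ratio2 R n n_gt0.
  split; apply: ltr_of_ln; rewrite ?powR_gt0 ?ratio_gt0//.
    by rewrite s24 ln_ratio24; exact: lo.
  by rewrite ln_powR ln_ratio24 (mulrC (1 / 4)) (mul1r 4^-1); exact: hi.
- move=> n2; have /andP[lo hi] := @ln_Omega_ratio_shift R n n_gt0 n2.
  have c0 : 0 < pi `^ (2 / ((n%:R - 2) * n%:R)) :> R.
    by rewrite powR_gt0 ?pi_gt0.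
  have p24 : 0 < ((n%:R + 2) / (n%:R + 4)) `^ (1 / 8) :> R by rewrite powR_gt0.
  rewrite mul1r ![_^-1 * _]mulrC.
  split; apply: ltr_of_ln; rewrite ?ratio_gt0 ?divr_gt0//.
    rewrite [X in X < _]ln_div ?posrE// s24 ln_ratio24 ln_powR ltrBlDr.
    exact: lo.
  rewrite [X in _ < X]ln_div ?posrE// !ln_powR ln_ratio24 ltrBrDr.
  by rewrite (mulrC (1 / 8)) (mul1r 8^-1); exact: hi.
- have /andP[lo hi] := @ln_Omega_ratio1 R n n_gt0.
  split; apply: ltr_of_ln; rewrite ?powR_gt0 ?ratio_gt0//.
    by rewrite s23 ln_ratio23; exact: lo.
  by rewrite ln_powR ln_ratio23 (mulrC (1 / 4)) (mul1r 4^-1); exact: hi.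
Qed.
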